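(* Let $G$ be a simple graph of order $n\geq 2$ that contains no isolated vertices. Then $I_RE(G)\leq \sqrt{2}+\sqrt{(n-1)(n-2)}$, and equality holds if and only if $G\cong K_n$.
   Context: All graphs are simple and finite. For a graph $G$ with vertex set $V(G)=\{v_1,\dots,v_n\}$, edge set $E(G)=\{e_1,\dots,e_m\}$ and degrees $d_i=\deg(v_i)$, the Randić incidence matrix $I_R(G)$ is the $n\times m$ matrix whose $(i,j)$-entry is $d_i^{-1/2}$ if $v_i$ is incident to $e_j$ and $0$ otherwise. Its singular values $\sigma_1(G),\dots,\sigma_n(G)$ are the square roots of the eigenvalues of the $n\times n$ matrix $I_R(G)I_R(G)^T$, and the Randić incidence energy is $I_RE(G)=\sum_{i=1}^n\sigma_i(G)$. *)

(* Defs.v *)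
From HB Require Import structures.
From mathcomp Require Import all_boot all_order all_algebra.
From mathcomp Require Import spectral complex polyrcf reals.

Set Implicit Arguments.
Unset Strict Implicit.
Unset Printing Implicit Defensive.

Import Order.TTheory GRing.Theory Num.Theory.
Local Open Scope ring_scope.

(* The eigenvalues lying in R, repeated according to their algebraic
   multiplicity. For symmetric A this is the full spectrum: see
   char_poly_eigenvalues and size_eigenvalues. *)
Definition eigenvalues (R : rcfType) (n : nat) (A : 'M[R]_n) : seq R :=
  flatten [seq nseq (mup x (char_poly A)) x | x <- rootsR (char_poly A)].

(* A *m A^T is positive semidefinite, so the convention Num.sqrt x = 0 for
   x < 0 plays no role here. *)
Definition singular_values (R : rcfType) (m n : nat) (A : 'M[R]_(m, n)) :
    seq R :=
  [seq Num.sqrt x | x <- eigenvalues (A *m A^T)].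

Record sgraph := SGraph {
  vertex :> finType;
  adj : rel vertex;
  adj_sym : symmetric adj;
  adj_irrefl : irreflexive adj }.

Definition edges (G : sgraph) : {set {set G}} :=
  [set [set p.1; p.2] | p : G * G & adj p.1 p.2].

Definition deg (G : sgraph) (v : G) : nat := #|[set w | adj v w]|.

Definition isolated (G : sgraph) (v : G) : bool := deg v == 0%N.

Definition isomorphic (G H : sgraph) : Prop :=
  exists2 f : G -> H, bijective f & {mono f : x y / adj x y}.

Section Complete.
Variable n : nat.

Definition complete_adj : rel 'I_n := fun x y => x != y.

Fact complete_sym : symmetric complete_adj.
Proof. by move=> x y; rewrite /complete_adj eq_sym. Qed.

Fact complete_irrefl : irreflexive complete_adj.
Proof. by move=> x; rewrite /complete_adj eqxx. Qed.

Definition complete : sgraph := SGraph complete_sym complete_irrefl.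

End Complete.

Definition randic_incidence (R : rcfType) (G : sgraph) :
    'M[R]_(#|G|, #|edges G|) :=
  \matrix_(i < #|G|, j < #|edges G|)
    let v : G := enum_val i in
    let e : {set G} := enum_val j in
    if v \in e then (Num.sqrt (deg v)%:R)^-1 else 0.

Definition randic_incidence_energy (R : rcfType) (G : sgraph) : R :=
  \sum_(s <- singular_values (randic_incidence R G)) s.

Lemma perm_eigenvalues (R : rcfType) (n : nat) (A : 'M[R]_n) (s : seq R) :
  char_poly A = \prod_(x <- s) ('X - x%:P) -> perm_eq (eigenvalues A) s.
Proof.
move=> As; have p0 : char_poly A != 0 by rewrite monic_neq0 ?char_poly_monic.
have ur : uniq (rootsR (char_poly A)) by apply: uniq_roots.
apply/allP => x _ /=; apply/eqP.
rewrite -(mu_prod_XsubC x s) -As /eigenvalues count_flatten sumnE !big_map.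
under eq_bigr => y _ do rewrite count_nseq /=.
have [xr|xNr] := boolP (x \in rootsR (char_poly A)).
  rewrite (bigD1_seq x) //= eqxx mul1n big1 ?addn0 // => y /negbTE ->.
  by rewrite mul0n.
rewrite big1_seq; last first.
  move=> y /= yr; case: eqP => [yx|]; last by rewrite mul0n.
  by rewrite -yx yr in xNr.
rewrite mupNroot //; apply: contra xNr => xr.
by rewrite -(roots_on_rootsR p0) inE /= xr.
Qed.

Lemma char_poly_conj (F : fieldType) (n : nat) (P D : 'M[F]_n) :
  P \in unitmx -> char_poly (invmx P *m D *m P) = char_poly D.
Proof.
move=> uP; have PK : map_mx polyC (invmx P) *m map_mx polyC P = 1%:M.
  by rewrite -map_mxM mulVmx // map_mx1.
rewrite /char_poly.
have -> : char_poly_mx (invmx P *m D *m P) =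
    map_mx polyC (invmx P) *m char_poly_mx D *m map_mx polyC P.
  rewrite /char_poly_mx !map_mxM mulmxBr mulmxBl; congr (_ - _).
  by rewrite mul_mx_scalar -scalemxAl PK scalemx1.
by rewrite !det_mulmx mulrAC -det_mulmx PK det1 mul1r.
Qed.

Lemma char_poly_sym_split (R : rcfType) (n : nat) (A : 'M[R]_n) :
  A^T = A -> exists s, char_poly A = \prod_(x <- s) ('X - x%:P).
Proof.
move=> Asym; pose f := real_complex R; pose B := map_mx f A.
have Bherm : B \is hermsymmx.
  apply: realsym_hermsym.
    by apply/is_hermitianmxP; rewrite expr0 scale1r map_mx_id // map_trmx Asym.
  by apply/mxOverP => i j; rewrite mxE complex_real.
have /orthomx_spectralP BE := hermitian_normalmx Bherm.
have /mxOverP spR := hermitian_spectral_diag_real Bherm.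
exists [seq complex.Re (spectral_diag B 0 i) | i <- enum 'I_n].
apply: (@map_poly_inj _ _ f).
rewrite map_char_poly -/B rmorph_prod /= big_map big_enum /=.
rewrite {1}BE char_poly_conj ?spectral_unit //.
rewrite char_poly_trig ?diag_mx_is_trig //; apply: eq_bigr => i _.
by rewrite rmorphB /= map_polyX map_polyC /= mxE eqxx mulr1n RRe_real.
Qed.

Lemma char_poly_eigenvalues (R : rcfType) (n : nat) (A : 'M[R]_n) :
  A^T = A -> char_poly A = \prod_(x <- eigenvalues A) ('X - x%:P).
Proof.
move=> /char_poly_sym_split[s As].
by rewrite (perm_big _ (perm_eigenvalues As)).
Qed.

Lemma size_eigenvalues (R : rcfType) (n : nat) (A : 'M[R]_n) :
  A^T = A -> size (eigenvalues A) = n.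
Proof.
move=> /char_poly_eigenvalues /(congr1 (fun p : {poly R} => size p)).
by rewrite size_char_poly size_prod_XsubC => -[].
Qed.

Lemma size_singular_values (R : rcfType) (m n : nat) (A : 'M[R]_(m, n)) :
  size (singular_values A) = m.
Proof. by rewrite size_map size_eigenvalues // trmx_mul trmxK. Qed.

(* Main.v *)
Require Import Defs.
From mathcomp Require Import all_boot all_order all_algebra reals.
From mathcomp Require Import spectral complex ring.

Import Order.TTheory GRing.Theory Num.Theory.
Local Open Scope ring_scope.

(* With d the degrees, Q = I_R I_R^T has unit diagonal and off-diagonal entries
   1/sqrt(d_i d_j) on adjacent pairs, 0 elsewhere. It is positive semidefinite
   with trace n, and v = (sqrt d_i)_i is an eigenvector for 2, so the other n-1
   eigenvalues are nonnegative with sum n-2; Cauchy-Schwarz on their square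
   roots gives the bound. Equality means that they all equal c = (n-2)/(n-1),
   that is, Q = c I + ((2-c)/|v|^2) v^T v. The right-hand side has nonzero
   off-diagonal entries, which forces G to be complete, and for complete G the
   identity is checked entrywise. *)

(** * Spectra of real symmetric matrices *)

(** Over [R[i]] the matrix is Hermitian, hence conjugate to a real diagonal matrix, and traces are
    invariant under conjugation. The second moment serves to compute a Frobenius norm. *)
Lemma sum_eigenvalues_tr {R : rcfType} {n : nat} {A : 'M[R]_n} :
  A^T = A ->
  \sum_(x <- eigenvalues A) x = \tr A /\
  \sum_(x <- eigenvalues A) x ^+ 2 = \tr (A *m A).
Proof.
move=> Asym; pose f := real_complex R; pose B := map_mx f A.
have Bherm : B \is hermsymmx.
  apply: realsym_hermsym.
    by apply/is_hermitianmxP; rewrite expr0 scale1r map_mx_id // map_trmx Asym.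
  by apply/mxOverP => i j; rewrite mxE complex_real.
have /orthomx_spectralP BE := hermitian_normalmx Bherm.
have /mxOverP spR := hermitian_spectral_diag_real Bherm.
pose P := spectralmx B; pose d := spectral_diag B.
rewrite -/P -/d in BE.
have uP : P \in unitmx by exact: spectral_unit.
have dK i : f (complex.Re (d 0 i)) = d 0 i by rewrite /f /= RRe_real.
pose s := [seq complex.Re (d 0 i) | i <- enum 'I_n].
(* The factorization descends from [R[i]] to [R] by injectivity of the embedding; it identifies
   [eigenvalues A] with [s] up to order. *)
have As : char_poly A = \prod_(x <- s) ('X - x%:P).
  apply: (@map_poly_inj _ _ f).
  rewrite map_char_poly -/B rmorph_prod /= big_map big_enum /=.
  rewrite {1}BE char_poly_conj // char_poly_trig ?diag_mx_is_trig //.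
  apply: eq_bigr => i _.
  by rewrite rmorphB /= map_polyX map_polyC /= mxE eqxx mulr1n -dK.
have sE := perm_eigenvalues As.
have trE (D : 'M_n) : \tr (invmx P *m D *m P) = \tr D.
  by rewrite mxtrace_mulC mulmxA mulmxV // mul1mx.
split; rewrite (perm_big _ sE) big_map big_enum /=; apply: (fmorph_inj f).
  rewrite -trace_map_mx -/B BE trE mxtrace_diag rmorph_sum /=.
  by apply: eq_bigr => i _; rewrite -dK.
rewrite -trace_map_mx map_mxM -/B BE !mulmxA mulmxK //.
rewrite -[_ *m diag_mx _ *m diag_mx _]mulmxA trE mulmx_diag mxtrace_diag.
rewrite rmorph_sum /=; apply: eq_bigr => i _.
by rewrite rmorphXn /= mxE -[in RHS]dK expr2.
Qed.

Lemma eigenvalueE {R : rcfType} {n : nat} {A : 'M[R]_n} (x : R) :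
  A^T = A -> eigenvalue A x = (x \in eigenvalues A).
Proof.
move=> /char_poly_eigenvalues AE.
by rewrite eigenvalue_root_char AE root_prod_XsubC.
Qed.

(** * Squared norms, Gram matrices and the rank-one criterion *)

Lemma row_sqnormE {R : comPzRingType} {n : nat} (v : 'rV[R]_n) :
  (v *m v^T) 0 0 = \sum_j v 0 j ^+ 2.
Proof. by rewrite mxE; apply: eq_bigr => j _; rewrite mxE expr2. Qed.

Lemma row_sqnorm_ge0 {R : realDomainType} {n : nat} (v : 'rV[R]_n) :
  0 <= (v *m v^T) 0 0.
Proof. by rewrite row_sqnormE sumr_ge0 // => j _; rewrite sqr_ge0. Qed.

Lemma row_sqnorm_eq0 {R : realDomainType} {n : nat} (v : 'rV[R]_n) :
  ((v *m v^T) 0 0 == 0) = (v == 0).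
Proof.
rewrite row_sqnormE psumr_eq0; last by move=> j _; rewrite sqr_ge0.
apply/allP/eqP => [v0|-> j _]; last by rewrite mxE expr0n eqxx.
apply/rowP => j; rewrite mxE; apply/eqP.
by rewrite -sqrf_eq0; apply: v0; rewrite mem_index_enum.
Qed.

Lemma tr_mulmx_trmx_eq0 {R : realDomainType} {m n : nat} (A : 'M[R]_(m, n)) :
  (\tr (A *m A^T) == 0) = (A == 0).
Proof.
have trE : \tr (A *m A^T) = \sum_i (row i A *m (row i A)^T) 0 0.
  apply: eq_bigr => i _; rewrite row_sqnormE mxE.
  by apply: eq_bigr => j _; rewrite !mxE expr2.
rewrite trE psumr_eq0; last by move=> i _; exact: (row_sqnorm_ge0 (row i A)).
apply/allP/eqP => [A0|-> i _]; last by rewrite row_sqnorm_eq0 row0 eqxx.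
apply/row_matrixP => i; rewrite row0; apply/eqP.
by rewrite -row_sqnorm_eq0; apply: A0; rewrite mem_index_enum.
Qed.

(** For an eigenvector [v] of [A *m A^T], the product of [x] and the squared norm of [v] is the
    squared norm of [v *m A]. *)
Lemma eigenvalues_gram_ge0 {R : rcfType} {m n : nat} (A : 'M[R]_(m, n))
    (x : R) :
  x \in eigenvalues (A *m A^T) -> 0 <= x.
Proof.
rewrite -eigenvalueE ?trmx_mul ?trmxK // => /eigenvalueP[v vA v0].
have v_gt0 : 0 < (v *m v^T) 0 0.
  by rewrite lt_def row_sqnorm_eq0 v0 row_sqnorm_ge0.
rewrite -(pmulr_lge0 _ v_gt0).
have -> : x * (v *m v^T) 0 0 = ((v *m A) *m (v *m A)^T) 0 0.
  by rewrite trmx_mul mulmxA -[v *m A *m _]mulmxA vA -scalemxAl [RHS]mxE.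
exact: row_sqnorm_ge0.
Qed.

(* The squared Frobenius norm of the difference of the two sides is
   \sum_(x <- s) (x - c) ^+ 2. *)
Lemma other_eigenvalues_const {R : rcfType} {n : nat} {A : 'M[R]_n}
    {v : 'rV[R]_n} {a : R} {s : seq R} (c : R) :
  A^T = A -> v *m A = a *: v -> v != 0 -> perm_eq (eigenvalues A) (a :: s) ->
  all (pred1 c) s <->
  A = c%:M + ((a - c) / (v *m v^T) 0 0) *: (v^T *m v).
Proof.
move=> Asym vA v0 sE; set N := (v *m v^T) 0 0.
have N0 : N != 0 by rewrite row_sqnorm_eq0.
have NE : v *m v^T = N%:M by rewrite [LHS]mx11_scalar.
set V := v^T *m v.
have trV : \tr V = N by rewrite mxtrace_mulC NE mxtrace_scalar mulr1n.
have VV : V *m V = N *: V.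
  by rewrite /V mulmxA -[v^T *m v *m v^T]mulmxA NE mul_mx_scalar -scalemxAl.
have VA : V *m A = a *: V by rewrite /V -mulmxA vA -scalemxAr.
have Vsym : V^T = V by rewrite trmx_mul trmxK.
have AV : A *m V = a *: V.
  by rewrite -[LHS]trmxK trmx_mul Asym Vsym VA linearZ /= Vsym.
(* Since [V] acts on [v] as multiplication by [N], this [k] makes [k *: V] account for the excess
   [a - c] in the direction of [v]. *)
set k := (a - c) / N; pose M := A - c%:M - k *: V.
have Msym : M^T = M by rewrite /M !linearB /= linearZ /= Asym Vsym tr_scalar_mx.
have [tr1 tr2] := sum_eigenvalues_tr Asym.
have szE : n = (size s).+1 by rewrite -(size_eigenvalues Asym) (perm_size sE).
have sumE : \sum_(x <- s) (x - c) ^+ 2 = \tr (M *m M^T).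
  have -> : \sum_(x <- s) (x - c) ^+ 2 =
      \sum_(x <- s) x ^+ 2 - c *+ 2 * (\sum_(x <- s) x) + (size s)%:R * c ^+ 2.
    elim: (s) => [|x t IH]; first by rewrite !big_nil mulr0 mul0r subr0 addr0.
    by rewrite !big_cons IH /= -[in (size t).+1%:R]natr1; ring.
  have {}tr1 : a + \sum_(x <- s) x = \tr A.
    by rewrite -tr1 (perm_big _ sE) big_cons.
  have {}tr2 : a ^+ 2 + \sum_(x <- s) x ^+ 2 = \tr (A *m A).
    by rewrite -tr2 (perm_big _ sE) big_cons.
  (* In the expanded trace the terms in [V] add up to [- (a - c) ^+ 2], which cancels the
     contribution of the eigenvalue [a]. *)
  rewrite Msym /M !(mulmxBl, mulmxBr) -!scalemxAl -!scalemxAr VV AV VA.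
  rewrite !mul_mx_scalar !mul_scalar_mx.
  rewrite !linearB /= !linearZ /= -tr2 -tr1 trV mxtrace_scalar szE.
  by rewrite -[in RHS]mulr_natl -natr1 /k; field.
transitivity (M == 0); last first.
  split=> [/eqP/subr0_eq/(canRL (subrK _)) -> | AE]; first by rewrite addrC.
  by rewrite /M AE addrAC addrK subrr.
rewrite -tr_mulmx_trmx_eq0 -sumE psumr_eq0; last by move=> x _; rewrite sqr_ge0.
by under eq_all => x do rewrite /= -subr_eq0 -sqrf_eq0.
Qed.

(** * Cauchy-Schwarz for sums of square roots *)

(* Lagrange-type defect identity, giving both Cauchy-Schwarz and its equality
   case without dividing. *)
Lemma sum_sqrt_defect {R : rcfType} {s : seq R} :
  {in s, forall x, 0 <= x} ->
  \sum_(x <- s) ((size s)%:R * Num.sqrt x - \sum_(y <- s) Num.sqrt y) ^+ 2 =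
  (size s)%:R *
    ((size s)%:R * \sum_(x <- s) x - (\sum_(x <- s) Num.sqrt x) ^+ 2).
Proof.
move=> s0; set T := \sum_(y <- s) Num.sqrt y; set k := (size s)%:R.
have -> : \sum_(x <- s) (k * Num.sqrt x - T) ^+ 2 =
    \sum_(x <- s) k ^+ 2 * x - \sum_(x <- s) (k * T *+ 2) * Num.sqrt x +
    \sum_(x <- s) T ^+ 2.
  rewrite -sumrB -big_split; apply: eq_big_seq => x /s0 x0 /=.
  by rewrite -[in k ^+ 2 * x](sqr_sqrtr x0); ring.
rewrite -!mulr_sumr -/T big_const_seq count_predT iter_addr_0 -mulr_natl -/k.
by ring.
Qed.

Lemma sum_sqrt_le {R : rcfType} {s : seq R} :
  {in s, forall x, 0 <= x} ->
  \sum_(x <- s) Num.sqrt x <= Num.sqrt ((size s)%:R * \sum_(x <- s) x).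
Proof.
move=> s0; set T := \sum_(x <- s) _.
have T0 : 0 <= T by apply: sumr_ge0 => x _; exact: sqrtr_ge0.
(* The defect identity carries a factor [size s], so it says nothing about the empty list. *)
have [s_gt0|] := ltnP 0 (size s); last first.
  by rewrite leqn0 size_eq0 /T => /eqP ->; rewrite !big_nil mulr0 sqrtr0.
rewrite -(ger0_norm T0) -sqrtr_sqr ler_wsqrtr // -subr_ge0.
have k0 : 0 < (size s)%:R :> R by rewrite ltr0n.
rewrite -(pmulr_rge0 _ k0) -sum_sqrt_defect // sumr_ge0 // => x _.
by rewrite sqr_ge0.
Qed.

(** Equality makes the sum of squares in the defect identity vanish, so all the square roots agree
    and each entry is the mean. *)
Lemma sum_sqrt_eq {R : rcfType} {s : seq R} :
  {in s, forall x, 0 <= x} ->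
  \sum_(x <- s) Num.sqrt x = Num.sqrt ((size s)%:R * \sum_(x <- s) x) <->
  all (pred1 ((\sum_(x <- s) x) / (size s)%:R)) s.
Proof.
move=> s0; set k := (size s)%:R; set S := \sum_(x <- s) x.
have S0 : 0 <= S by rewrite /S big_seq sumr_ge0.
have kS0 : 0 <= k * S by rewrite mulr_ge0 ?ler0n.
have [s_gt0|] := ltnP 0 (size s); last first.
  by rewrite leqn0 size_eq0 /S /k => /eqP ->; rewrite !big_nil mulr0 sqrtr0.
have k0 : 0 < k by rewrite ltr0n.
split=> [TE|/all_pred1P sE].
  have := sum_sqrt_defect s0.
  rewrite TE -/k -/S sqr_sqrtr // subrr mulr0 => /eqP.
  rewrite psumr_eq0 => [/allP eq0|x _]; last exact: sqr_ge0.
  apply/allP => x xs; have := eq0 x xs; rewrite sqrf_eq0 subr_eq0 /= => /eqP e.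
  (* Squaring [k * Num.sqrt x = Num.sqrt (k * S)] gives [k ^+ 2 * x = k * S], whence [x = S / k]. *)
  have := congr1 (fun y => y ^+ 2) e.
  rewrite exprMn (sqr_sqrtr kS0) (sqr_sqrtr (s0 x xs)) => {}e.
  apply/eqP; apply: (mulfI (lt0r_neq0 (mulr_gt0 k0 k0))).
  by rewrite -expr2 e; field; rewrite lt0r_neq0.
set c := S / k in sE.
have -> : k * S = k ^+ 2 * c by rewrite /c; field; rewrite lt0r_neq0.
rewrite sE big_nseq iter_addr_0 sqrtrM ?sqr_ge0 // sqrtr_sqr ger0_norm ?ltW //.
by rewrite mulr_natl.
Qed.

(** * Counting edges through given vertices *)

Lemma edgesP {G : sgraph} (e : {set G}) :
  reflect (exists x y, adj x y /\ e = [set x; y]) (e \in edges G).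
Proof.
apply: (iffP imsetP) => [[[x y]]|[x [y [xy ->]]]].
  by rewrite inE /= => xy ->; exists x, y.
by exists (x, y); rewrite ?inE.
Qed.

Lemma set2_inj {T : finType} (x : T) : injective (fun y => [set x; y]).
Proof.
move=> y z /setP yz; have := yz y; have := yz z; rewrite !inE !eqxx !orbT.
by case: (eqVneq y x) => [->|_] /=; [rewrite orbb => /eqP|move=> _ /esym/eqP].
Qed.

(** The edges at [x] are the images of its neighbours under the injection sending [y] to
    [[set x; y]]. *)
Lemma card_edges_at {G : sgraph} (x : G) :
  #|[set e in edges G | x \in e]| = deg x.
Proof.
rewrite /deg -(card_imset _ (@set2_inj _ x)); apply: eq_card => e.
rewrite inE; apply/andP/imsetP => [[/edgesP[y [z [yz ->]]]]|[y]].
  rewrite !inE => /orP[]/eqP xE; first by exists z; rewrite ?inE xE.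
  by exists y; rewrite ?inE xE 1?adj_sym // setUC.
rewrite inE => xy ->; split; last by rewrite !inE eqxx.
by apply/edgesP; exists x, y.
Qed.

(** Only [[set x; y]] can be an edge through two distinct vertices, so the count is the boolean
    [adj x y] read as 0 or 1. *)
Lemma card_edges_at2 {G : sgraph} (x y : G) : x != y ->
  #|[set e in edges G | (x \in e) && (y \in e)]| = adj x y.
Proof.
move=> xDy; have [xy|/negP xNy] := boolP (adj x y); last first.
  apply/eqP; rewrite cards_eq0; apply/eqP/setP => e; rewrite !inE.
  apply/negP => /and3P[/edgesP[u [w [uw ->]]]]; rewrite !inE.
  case/orP=> /eqP xE /orP[]/eqP yE; rewrite xE yE ?eqxx // in xDy xNy => //.
  by rewrite adj_sym in uw.
rewrite -[RHS](cards1 [set x; y]); apply: eq_card => e; rewrite !inE.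
apply/and3P/eqP => [[/edgesP[u [w [uw ->]]]]|->].
  rewrite !inE => /orP[]/eqP xE /orP[]/eqP yE; rewrite xE yE ?eqxx // in xDy *.
  by rewrite setUC.
by rewrite !inE !eqxx orbT; split=> //; apply/edgesP; exists x, y.
Qed.

(** * The Gram matrix of the Randić incidence matrix *)

Definition sqrt_deg (R : rcfType) {G : sgraph} (x : G) : R :=
  Num.sqrt (deg x)%:R.

Definition sqrt_deg_row (R : rcfType) (G : sgraph) : 'rV[R]_#|G| :=
  \row_i sqrt_deg R (enum_val i).

Section RandicGram.
Variables (R : rcfType) (G : sgraph).
Hypothesis no_isolated : forall v : G, ~~ isolated v.

Local Notation r := (@sqrt_deg R G).
Local Notation v := (@sqrt_deg_row R G).
Local Notation Q := (randic_incidence R G *m (randic_incidence R G)^T).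

Lemma sqrt_deg_gt0 x : 0 < r x.
Proof. by rewrite sqrtr_gt0 ltr0n lt0n; exact: no_isolated. Qed.
Let r_neq0 x : r x != 0 := lt0r_neq0 (sqrt_deg_gt0 x).

Lemma sqr_sqrt_deg x : r x ^+ 2 = (deg x)%:R.
Proof. by rewrite sqr_sqrtr ?ler0n. Qed.

(** Each edge containing both vertices contributes the inverse of the product of their [sqrt_deg].
    On the diagonal there are [deg x] such edges, which gives 1. *)
Lemma randic_gramE i j :
  Q i j = (i == j)%:R +
    (adj (enum_val i) (enum_val j))%:R / (r (enum_val i) * r (enum_val j)).
Proof.
set x : G := enum_val i; set y : G := enum_val j.
have -> : Q i j =
    #|[set e in edges G | (x \in e) && (y \in e)]|%:R / (r x * r y).
  rewrite mxE -[#|[set e in _ | _]|]sum1_card natr_sum mulr_suml.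
  transitivity (\sum_(e in edges G)
      (if (x \in e) && (y \in e) then (r x * r y)^-1 else 0)).
    rewrite [RHS]big_enum_val; apply: eq_bigr => k _; rewrite !mxE -/x -/y.
    move=> /=; case: (x \in _); case: (y \in _) => /=;
      by rewrite ?mulr0 ?mul0r // invfM.
  under [RHS]eq_bigl => e do rewrite inE.
  by rewrite [RHS]big_mkcondr; apply: eq_bigr => e _; rewrite mul1r.
have [ij|iDj] := eqVneq i j.
  have -> : y = x by rewrite /y -ij.
  rewrite adj_irrefl mul0r addr0 -expr2 sqr_sqrt_deg.
  have -> : [set e in edges G | (x \in e) && (x \in e)] =
      [set e in edges G | x \in e].
    by apply/setP => e; rewrite !inE andbb.
  by rewrite card_edges_at divff // -sqr_sqrt_deg sqrf_eq0.
by rewrite card_edges_at2 ?add0r // (inj_eq enum_val_inj).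
Qed.

Lemma randic_gram_sym : Q^T = Q.
Proof. by rewrite trmx_mul trmxK. Qed.

(** The identity part returns [v]. In the adjacency part each neighbour of [y] contributes
    [(r y)^-1], and the [deg y] of them add up to [r y], so [v] is returned again. *)
Lemma randic_gram_eigen : v *m Q = 2 *: v.
Proof.
apply/rowP => j; rewrite !mxE; set y : G := enum_val j.
under eq_bigr => i _ do rewrite randic_gramE mxE mulrDr.
rewrite big_split /= (bigD1 j) //= eqxx mulr1 big1 ?addr0; last first.
  by move=> i /negbTE ->; rewrite mulr0.
rewrite -(big_enum_val (fun x : G => r x * ((adj x y)%:R / (r x * r y)))) /=.
under eq_bigr => x _ do rewrite invfM mulrCA mulVKf ?r_neq0 // adj_sym.
rewrite -mulr_suml -natr_sum -[in r y]/y.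
have -> : (\sum_(x : G) adj y x)%N = deg y.
  rewrite /deg -sum1_card [RHS]big_mkcond /=; apply: eq_bigr => x _.
  by rewrite inE; case: adj.
by rewrite -sqr_sqrt_deg expr2 mulfK // mulr2n mulrDl !mul1r.
Qed.

Lemma tr_randic_gram : \tr Q = #|G|%:R.
Proof.
rewrite /mxtrace.
under eq_bigr => i _ do
  rewrite randic_gramE eqxx adj_irrefl mul0r addr0.
by rewrite sumr_const card_ord.
Qed.

Lemma sqrt_deg_row_neq0 : (0 < #|G|)%N -> v != 0.
Proof.
move=> G0; apply/eqP => /rowP /(_ (Ordinal G0)); rewrite !mxE => /eqP.
by apply/negP.
Qed.

(** Here [c] is the mean of the eigenvalues other than one copy of 2: their sum is [#|G| - 2] and
    their number [#|G| - 1]. *)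
Lemma randic_gram_rank1P : (1 < #|G|)%N ->
  let c := (#|G|%:R - 2) / (#|G|%:R - 1) in
  Q = c%:M + ((2 - c) / (v *m v^T) 0 0) *: (v^T *m v) <->
  (forall x y : G, adj x y = (x != y)).
Proof.
move=> G_gt1 c; set N := (v *m v^T) 0 0; set n : R := #|G|%:R.
have n1 : n - 1 != 0 by rewrite subr_eq0 pnatr_eq1 neq_ltn G_gt1 orbT.
have n0 : n != 0 by rewrite pnatr_eq0 -lt0n ltnW.
have cE : 2 - c = n / (n - 1) by rewrite /c; field.
have N0 : N != 0 by rewrite row_sqnorm_eq0 sqrt_deg_row_neq0 // ltnW.
split=> [QE x y | adjE].
  have [->|xDy] := eqVneq x y; first by rewrite adj_irrefl.
  (* At a non-adjacent pair of distinct vertices the left entry is 0. Every factor of the right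
     entry except [N^-1] is nonzero, so [N^-1 = 0], that is, [N = 0] since the inverse of 0 is 0. *)
  apply: contraNT (N0) => xNy.
  have := congr1 (fun M : 'M_#|G| => M (enum_rank x) (enum_rank y)) QE.
  rewrite randic_gramE !enum_rankK (negbTE xNy) mul0r !mxE big_ord1 !mxE.
  rewrite !enum_rankK.
  rewrite (inj_eq enum_rank_inj) (negbTE xDy) mulr0n !add0r cE.
  move=> /esym/eqP.
  rewrite !mulf_eq0 !invr_eq0 (negbTE n0) (negbTE n1) !(negbTE (r_neq0 _)).
  by rewrite !orbF.
have degE (x : G) : (deg x)%:R = n - 1.
  have -> : deg x = #|G|.-1.
    by rewrite -(cardC1 x); apply: eq_card => y; rewrite !inE adjE eq_sym.
  by rewrite /n -[in RHS](prednK (ltnW G_gt1)) -natr1 addrK.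
(* The rank-one coefficient thus becomes [(n - 1) ^- 2]; multiplied by [r x * r y = n - 1] it gives
   the off-diagonal entry [(n - 1)^-1]. *)
have NE : N = n * (n - 1).
  rewrite /N row_sqnormE; under eq_bigr => i _ do rewrite mxE sqr_sqrt_deg degE.
  by rewrite sumr_const card_ord mulr_natl.
have rE x y : r x * r y = n - 1.
  by rewrite /sqrt_deg !degE -expr2 -(degE x) sqr_sqrt_deg.
apply/matrixP => i j; rewrite randic_gramE !mxE big_ord1 !mxE !rE adjE.
rewrite (inj_eq enum_val_inj) cE NE /c -/n.
by case: (i == j); rewrite /= ?mulr1n ?mulr0n; field; rewrite n1 n0.
Qed.

End RandicGram.

(** * Complete graphs and the energy bound *)

Lemma isomorphic_completeP {n : nat} {G : sgraph} : #|G| = n ->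
  isomorphic G (complete n) <-> (forall x y : G, adj x y = (x != y)).
Proof.
move=> Gn; split=> [[f fbij fmono] x y|adjE].
  by rewrite -fmono /= /complete_adj (inj_eq (bij_inj fbij)).
have finj : injective (fun x : G => cast_ord Gn (enum_rank x)).
  by move=> x y /cast_ord_inj/enum_rank_inj.
exists (fun x : G => cast_ord Gn (enum_rank x)).
  by apply: inj_card_bij => //=; rewrite card_ord Gn.
by move=> x y; rewrite adjE /= /complete_adj (inj_eq finj).
Qed.

Theorem theorem2p2 (R : realType) (n : nat) (G : sgraph)
    (n_ge2 : (2 <= n)%N) (order_G : #|G| = n)
    (no_isolated : forall v : G, ~~ isolated v) :
  randic_incidence_energy R G
    <= Num.sqrt 2 + Num.sqrt ((n%:R - 1) * (n%:R - 2))
  /\ (randic_incidence_energy R G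
        = Num.sqrt 2 + Num.sqrt ((n%:R - 1) * (n%:R - 2))
      <-> isomorphic G (complete n)).
Proof.
have G_gt1 : (1 < #|G|)%N by rewrite order_G.
have Qsym := randic_gram_sym R G.
have vQ := randic_gram_eigen R G no_isolated.
have v0 := sqrt_deg_row_neq0 R G no_isolated (ltnW G_gt1).
(* Isomorphism with the complete graph is turned into the rank-one identity, which is later traded
   for constancy of the remaining eigenvalues. *)
rewrite (isomorphic_completeP order_G).
rewrite -(randic_gram_rank1P R G no_isolated G_gt1).
rewrite /randic_incidence_energy /singular_values big_map.
set Q := _ *m _ in Qsym vQ *; set v := sqrt_deg_row R G in vQ v0 *.
have : 2 \in eigenvalues Q.
  by rewrite -eigenvalueE //; apply/eigenvalueP; exists v.
(* Only one copy of 2 is removed, so [s] keeps any further occurrences and has [n - 1] entries. *)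
move=> /perm_to_rem; set s := rem _ _ => sE.
have [trE _] := sum_eigenvalues_tr Qsym.
have s0 : {in s, forall x, 0 <= x}.
  move=> x xs; apply: (eigenvalues_gram_ge0 (randic_incidence R G)).
  by rewrite (perm_mem sE) inE xs orbT.
have sumE : \sum_(x <- s) x = n%:R - 2.
  move: trE; rewrite (perm_big _ sE) big_cons tr_randic_gram // order_G => <-.
  by rewrite addrC addKr.
have sizeE : (size s)%:R = n%:R - 1 :> R.
  have := size_eigenvalues Qsym; rewrite (perm_size sE) order_G /= => <-.
  by rewrite -natr1 addrK.
(* The constant inferred here is the mean of [s], exactly the one in the equality case of
   Cauchy-Schwarz. *)
rewrite -(other_eigenvalues_const _ Qsym vQ v0 sE) (perm_big _ sE) big_cons.
have := sum_sqrt_le s0; have := sum_sqrt_eq s0.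
rewrite sumE sizeE order_G => sqrt_eq sqrt_le.
split; first by rewrite lerD2l.
by rewrite -sqrt_eq; split=> [/addrI|->].
Qed.
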